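(* Let $\mathcal{G}$ be an undirected and connected matrix-weighted graph on $\{1,\dots,n\}$ with symmetric matrix weights $\mathbf{A}_{ij}=\mathbf{A}_{ji}\ge 0$ in $\mathbb{R}^{d\times d}$ ($d\ge 2$), matrix-weighted Laplacian $\mathbf{L}$ and block degrees $\mathbf{D}_i$. Let $\beta>0$ and $\alpha=1/(\max_{i}\|\mathbf{D}_i\|+\beta)$. Consider the iteration $$\mathbf{x}(k+1)=(\mathbf{I}_{dn}-\alpha\mathbf{L})\mathbf{x}(k),\qquad k=0,1,2,\dots$$ Then the following are equivalent: (a) for every initial vector $\mathbf{x}(0)\in\mathbb{R}^{dn}$, the sequence $\{\mathbf{x}(k)\}$ converges geometrically to the average consensus $\mathbf{x}^*=\mathbf{1}_n\otimes\bar{\mathbf{x}}$, where $\bar{\mathbf{x}}=\frac1n(\mathbf{1}_n^\top\otimes\mathbf{I}_d)\mathbf{x}(0)$; (b) $\mathrm{null}(\mathbf{L})=\mathrm{range}(\mathbf{1}_n\otimes\mathbf{I}_d)$.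
   Context: A matrix-weighted graph $\mathcal{G}=(\mathcal{V},\mathcal{E},\mathcal{A})$ has vertex set $\mathcal{V}=\{1,\dots,n\}$, edge set $\mathcal{E}\subseteq\mathcal{V}\times\mathcal{V}$ without self-loops, and a weight $\mathbf{A}_{ij}\in\mathbb{R}^{d\times d}$ for each $(i,j)\in\mathcal{E}$ that is a symmetric positive semidefinite matrix; $\mathbf{A}_{ij}=\mathbf{0}$ if $(i,j)\notin\mathcal{E}$. The graph is undirected: $(i,j)\in\mathcal{E}$ implies $(j,i)\in\mathcal{E}$. $\mathcal{N}_i=\{j:(i,j)\in\mathcal{E}\}$. Symmetric matrix weights means $\mathbf{A}_{ij}=\mathbf{A}_{ji}$ for all $(i,j)\in\mathcal{E}$. $\mathbf{D}_i=\sum_{j\in\mathcal{N}_i}\mathbf{A}_{ij}$, $\mathbf{D}=\mathrm{diag}(\mathbf{D}_1,\dots,\mathbf{D}_n)$, $\mathbf{A}=[\mathbf{A}_{ij}]\in\mathbb{R}^{nd\times nd}$, and the matrix-weighted Laplacian is $\mathbf{L}=\mathbf{D}-\mathbf{A}$. $\|\cdot\|$ is the Euclidean norm on vectors and the induced (spectral) norm on matrices; $\mathbf{1}_n$ is the all-ones vector in $\mathbb{R}^n$. The state $\mathbf{x}(k)=[\mathbf{x}_1^\top(k),\dots,\mathbf{x}_n^\top(k)]^\top$ stacks the agents' vectors $\mathbf{x}_i(k)\in\mathbb{R}^d$. Converging geometrically to $\mathbf{x}^*$ means there exist $C\ge 0$ and $q\in[0,1)$ with $\|\mathbf{x}(k)-\mathbf{x}^*\|\le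 Cq^k$ for all $k$. *)

(* Defs.v *)
From mathcomp Require Import all_boot all_order all_algebra.
From mathcomp Require Import classical_sets reals.
Set Implicit Arguments.
Unset Strict Implicit.
Unset Printing Implicit Defensive.
Import Order.TTheory GRing.Theory Num.Theory.

Local Open Scope classical_set_scope.
Local Open Scope ring_scope.

(* The norm `|v| that MathComp-Analysis puts on matrices is the max norm, so
   the Euclidean and spectral norms are defined here. *)
Definition enorm (R : realType) (m : nat) (v : 'cV[R]_m) : R :=
  Num.sqrt (\sum_(i < m) v i 0 ^+ 2).

Definition spectral_norm (R : realType) (m p : nat) (M : 'M[R]_(m, p)) : R :=
  sup [set enorm (M *m v) | v in [set v : 'cV[R]_p | enorm v = 1]].

Definition symmetric_psd (R : realType) (d : nat) (M : 'M[R]_d) : Prop :=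
  M^T = M /\ forall v : 'cV[R]_d, 0 <= (v^T *m M *m v) 0 0.

Definition null_space (R : realType) (m p : nat) (M : 'M[R]_(m, p)) :
    set 'cV[R]_p :=
  [set x | M *m x = 0].

Definition range_space (R : realType) (m p : nat) (M : 'M[R]_(m, p)) :
    set 'cV[R]_m :=
  range (fun y : 'cV[R]_p => M *m y).

(* Vectors of R^(nd) made of n blocks of size d are indexed by
   'I_(\sum_(i < n) d), the index type of MathComp's uniform block matrices;
   agent i's vector is the block submxcol x i. *)

(* Kronecker products u (x) B for a column vector u, resp. a row vector u.
   Having these two cases separately avoids a spurious \sum_(j < 1) q in the
   other dimension. *)
Definition col_kron (R : realType) (n p q : nat) (u : 'cV[R]_n)
    (B : 'M[R]_(p, q)) : 'M[R]_(\sum_(i < n) p, q) :=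
  \mxcol_(i < n) (u i 0 *: B).

Definition row_kron (R : realType) (n p q : nat) (u : 'rV[R]_n)
    (B : 'M[R]_(p, q)) : 'M[R]_(p, \sum_(i < n) q) :=
  \mxrow_(i < n) (u 0 i *: B).

Definition ones (R : realType) (n : nat) : 'cV[R]_n := const_mx 1.
Arguments ones {R}.

(* The weight of an edge is allowed to be singular, and even zero. *)
Record mwgraph (R : realType) (n d : nat) := MWGraph {
  edge : rel 'I_n;
  weight : 'I_n -> 'I_n -> 'M[R]_d;
  edge_irrefl : irreflexive edge;
  weight_psd : forall i j, edge i j -> symmetric_psd (weight i j);
  weight_nonedge : forall i j, ~~ edge i j -> weight i j = 0
}.

Section GraphNotions.
Variables (R : realType) (n d : nat) (G : mwgraph R n d).

Definition undirected : Prop := symmetric (edge G).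

Definition symmetric_weights : Prop :=
  forall i j, edge G i j -> weight G i j = weight G j i.

Definition connected_graph : Prop := forall i j, connect (edge G) i j.

Definition block_degree (i : 'I_n) : 'M[R]_d :=
  \sum_(j < n | edge G i j) weight G i j.

Definition degree_matrix : 'M[R]_(\sum_(i < n) d) :=
  \mxdiag_(i < n) block_degree i.

Definition adjacency_matrix : 'M[R]_(\sum_(i < n) d) :=
  \mxblock_(i < n, j < n) weight G i j.

Definition laplacian : 'M[R]_(\sum_(i < n) d) :=
  degree_matrix - adjacency_matrix.

(* The default value 0 is harmless since norms are nonnegative. *)
Definition max_degree_norm : R :=
  \big[Num.max/0]_(i < n) spectral_norm (block_degree i).

End GraphNotions.

Definition converges_geometrically (R : realType) (m : nat)
    (x : nat -> 'cV[R]_m) (xstar : 'cV[R]_m) : Prop :=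
  exists C q : R, [/\ 0 <= C, 0 <= q, q < 1 &
    forall k, enorm (x k - xstar) <= C * q ^+ k].

Definition block_average (R : realType) (n d : nat)
    (x0 : 'cV[R]_(\sum_(i < n) d)) : 'cV[R]_d :=
  n%:R^-1 *: (row_kron (ones n)^T 1%:M *m x0).

(* Main.v *)
Require Import Defs.
From mathcomp Require Import all_boot all_order all_algebra.
From mathcomp Require Import classical_sets reals.
From mathcomp Require Import ring lra.
Set Implicit Arguments.
Unset Strict Implicit.
Unset Printing Implicit Defensive.
Import Order.TTheory GRing.Theory Num.Theory.
Local Open Scope ring_scope.

(** The iteration matrix is 1 - S with S = alpha L, and the proof controls it
    through quadratic forms, without diagonalising L.

    Since the weights are symmetric and positive semidefinite, the forms of
    D - A and D + A are both half a sum of terms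
    (x_i -+ x_j)^T A_ij (x_i -+ x_j), hence nonnegative
    ([degree_signed_adjacency_ge0]). So 0 <= L <= 2 D <= 2 mu with
    mu = max_i |D_i|, and alpha = 1 / (mu + beta) leaves a gap:
    0 <= S <= 2 - delta with delta = 2 alpha beta > 0.

    For such an S, Cauchy-Schwarz for semidefinite forms gives
    |S v|^2 <= (2 - delta) v^T S v, whence
    |(1 - S) v|^2 <= |v|^2 - delta v^T S v; and on the range of S the form is
    bounded below by a positive multiple of |v|^2 ([psd_coercive]). So 1 - S is
    a strict contraction on range S ([psd_contraction]).

    (b) implies (a). Let E = 1_n (x) I_d. The error e(k) = x(k) - x* satisfies
    E^T e(0) = 0 by the choice of the average, and 1 - S preserves this because
    L E = 0 and L is symmetric. If null L = range E, the kernel of E^T is the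
    orthogonal complement of null L, that is range L
    ([block_sum0_in_range]), so every error is contracted by the same factor.

    (a) implies (b). A vector of null L is a constant trajectory; if it
    converges to its average consensus it equals it, so it lies in range E. The
    other inclusion is L E = 0. *)

(** * Bilinear forms and the Euclidean norm *)

Definition form (R : realType) (m : nat) (S : 'M[R]_m) (u v : 'cV[R]_m) : R :=
  (u^T *m S *m v) 0 0.

Lemma formE (R : realType) (m : nat) (S : 'M[R]_m) (u v : 'cV[R]_m) :
  form S u v = \sum_i \sum_j u i 0 * S i j * v j 0.
Proof.
rewrite /form mxE exchange_big /=; apply: eq_bigr => j _.
by rewrite mxE mulr_suml; apply: eq_bigr => i _; rewrite mxE.
Qed.

Section Form.
Variables (R : realType) (m : nat).
Implicit Types (S T : 'M[R]_m) (u v w : 'cV[R]_m) (a : R).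

Lemma formDl S u v w : form S (u + v) w = form S u w + form S v w.
Proof. by rewrite /form linearD /= !mulmxDl mxE. Qed.

Lemma formDr S u v w : form S w (u + v) = form S w u + form S w v.
Proof. by rewrite /form mulmxDr mxE. Qed.

Lemma formZl S a u w : form S (a *: u) w = a * form S u w.
Proof. by rewrite /form linearZ /= -!scalemxAl mxE. Qed.

Lemma formZr S a u w : form S w (a *: u) = a * form S w u.
Proof. by rewrite /form -!scalemxAr mxE. Qed.

Lemma formNl S u w : form S (- u) w = - form S u w.
Proof. by rewrite -scaleN1r formZl mulN1r. Qed.

Lemma formNr S u w : form S w (- u) = - form S w u.
Proof. by rewrite -scaleN1r formZr mulN1r. Qed.

Lemma formZmx S a u v : form (a *: S) u v = a * form S u v.
Proof. by rewrite /form -scalemxAr -!scalemxAl mxE. Qed.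

Lemma formBmx S T u v : form (S - T) u v = form S u v - form T u v.
Proof. by rewrite /form mulmxBr mulmxBl !mxE. Qed.

Lemma form_mulr S u v : form 1%:M u (S *m v) = form S u v.
Proof. by rewrite /form mulmx1 mulmxA. Qed.

Lemma formC S u v : S^T = S -> form S u v = form S v u.
Proof.
move=> sS; rewrite /form; have <- : (v^T *m S *m u)^T = u^T *m S *m v.
  by rewrite !trmx_mul trmxK sS mulmxA.
by rewrite mxE.
Qed.

Definition sqnorm v : R := form 1%:M v v.

Lemma sqnormE v : sqnorm v = \sum_i v i 0 ^+ 2.
Proof.
rewrite /sqnorm /form mulmx1 mxE; apply: eq_bigr => i _.
by rewrite mxE expr2.
Qed.

Lemma sqnorm_ge0 v : 0 <= sqnorm v.
Proof. by rewrite sqnormE sumr_ge0 // => i _; rewrite sqr_ge0. Qed.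

Lemma sqnorm_eq0 v : (sqnorm v == 0) = (v == 0).
Proof.
apply/eqP/eqP => [|->]; last by rewrite /sqnorm /form mulmx0 mxE.
rewrite sqnormE => /eqP; rewrite psumr_eq0 => [/allP v0|i _]; last first.
  exact: sqr_ge0.
apply/colP => i; rewrite mxE; apply/eqP; rewrite -sqrf_eq0.
by apply: v0; rewrite mem_index_enum.
Qed.

Lemma enormE v : enorm v = Num.sqrt (sqnorm v).
Proof. by rewrite /enorm sqnormE. Qed.

Lemma enorm_sqr v : enorm v ^+ 2 = sqnorm v.
Proof. by rewrite enormE sqr_sqrtr ?sqnorm_ge0. Qed.

Lemma enorm_ge0 v : 0 <= enorm v.
Proof. by rewrite enormE sqrtr_ge0. Qed.

Lemma psd_scalar1 : symmetric_psd (1%:M : 'M[R]_m).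
Proof. by split; [rewrite trmx1 | exact: sqnorm_ge0]. Qed.

(** The discriminant argument: t |-> (u + t v)^T S (u + t v) stays nonnegative.
    As S may be singular, v^T S v = 0 is treated apart. *)
Lemma psd_CauchySchwarz S u v : symmetric_psd S ->
  form S u v ^+ 2 <= form S u u * form S v v.
Proof.
move=> [sS S0].
have E t : 0 <= form S u u + 2 * t * form S u v + t ^+ 2 * form S v v.
  have := S0 (u + t *: v); rewrite -/(form S _ _).
  rewrite !(formDl, formDr, formZl, formZr) (formC v u sS); lra.
have uu0 : 0 <= form S u u by exact: S0.
have vv0 : 0 <= form S v v by exact: S0.
move: (form S u u) (form S u v) (form S v v) E uu0 vv0 => a b c E a0 c0.
have [c_eq0|c_neq0] := eqVneq c 0.
  rewrite c_eq0 mulr0; have [->|b0] := eqVneq b 0; first by rewrite expr0n.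
  (* The polynomial is affine with slope 2 b; this t gives it the value -1. *)
  have := E (- (a + 1) / (2 * b)); rewrite c_eq0 mulr0 addr0.
  have -> : a + 2 * (- (a + 1) / (2 * b)) * b = -1 by field.
  lra.
(* t = - b / c is the vertex of the parabola. *)
have := E (- b / c).
have -> : a + 2 * (- b / c) * b + (- b / c) ^+ 2 * c = (a * c - b ^+ 2) / c.
  by field.
by rewrite pmulr_lge0 ?invr_gt0 ?lt_def ?c_neq0 // subr_ge0.
Qed.

Lemma form_le_sqnorm S :
  exists2 K, 0 < K & forall v, form S v v <= K * sqnorm v.
Proof.
exists (1 + \sum_i \sum_j `|S i j|) => [|v].
  by rewrite ltr_pwDl // sumr_ge0 // => i _; rewrite sumr_ge0.
rewrite mulrDl mul1r ler_wpDl ?sqnorm_ge0 // formE mulr_suml.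
apply: ler_sum => i _; rewrite mulr_suml; apply: ler_sum => j _.
have le_coord k : `|v k 0| <= enorm v.
  rewrite -(@ler_pXn2r _ 2) ?nnegrE ?enorm_ge0 // enorm_sqr sqnormE.
  rewrite real_normK ?num_real // (bigD1 k) //= lerDl sumr_ge0 // => l _.
  exact: sqr_ge0.
rewrite (le_trans (ler_norm _)) // !normrM mulrAC mulrC ler_wpM2l //.
by rewrite -enorm_sqr expr2 ler_pM.
Qed.

(** A substitute for the smallest nonzero eigenvalue. A vector v of the range
    is S u with u = P v for a fixed matrix P, so
    |v|^4 = (u^T S v)^2 <= (u^T S u) (v^T S v) <= K |v|^2 (v^T S v). *)
Lemma psd_coercive S : symmetric_psd S ->
  exists2 c, 0 < c &
    forall w, c * sqnorm (S *m w) <= form S (S *m w) (S *m w).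
Proof.
move=> psdS; have [sS S0] := psdS.
pose P := (pinvmx S)^T.
have [K K0 leK] := form_le_sqnorm (P^T *m S *m P).
exists K^-1 => [|w]; first by rewrite invr_gt0.
set v := S *m w.
have Ev : S *m (P *m v) = v.
  apply: trmx_inj; rewrite trmx_mul (trmx_mul P) {1}/P trmxK sS mulmxKpV //.
  by rewrite /v trmx_mul sS submxMl.
have := psd_CauchySchwarz (P *m v) v psdS.
have -> : form S (P *m v) v = sqnorm v.
  by rewrite formC // -form_mulr Ev.
have : form S (P *m v) (P *m v) <= K * sqnorm v.
  by have := leK v; rewrite /form (trmx_mul P v) !mulmxA.
have v0 := sqnorm_ge0 v; have S0v : 0 <= form S v v by exact: S0.
move: (form S (P *m v) _) (form S v v) (sqnorm v) v0 S0v => a b c c0 b0 ac cab.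
have [->|cn0] := eqVneq c 0; first by rewrite mulr0.
have cp : 0 < c by rewrite lt_def cn0.
have K_c : c ^+ 2 <= K * c * b by rewrite (le_trans cab) // ler_wpM2r.
rewrite ler_pdivrMl // -(ler_pM2r cp); lra.
Qed.

(** In spectral terms S^2 <= a S when 0 <= S <= a; it follows from
    |S v|^4 = (v^T S (S v))^2 <= (v^T S v) ((S v)^T S (S v))
    <= (v^T S v) a |S v|^2. *)
Lemma psd_sqnorm_mul_le S a : symmetric_psd S -> 0 <= a ->
    (forall v, form S v v <= a * sqnorm v) ->
  forall v, sqnorm (S *m v) <= a * form S v v.
Proof.
move=> psdS a0 Sa v; have [sS S0] := psdS.
have := psd_CauchySchwarz v (S *m v) psdS.
have -> : form S v (S *m v) = sqnorm (S *m v) by rewrite formC // -form_mulr.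
have := Sa (S *m v).
have v0 := sqnorm_ge0 (S *m v); have S0v : 0 <= form S v v by exact: S0.
move: (form S (S *m v) _) (form S v v) (sqnorm (S *m v)) v0 S0v.
move=> b s c c0 s0 bc cb.
have [->|cn0] := eqVneq c 0; first exact: mulr_ge0.
have cp : 0 < c by rewrite lt_def cn0.
rewrite -(ler_pM2r cp) -expr2 (le_trans cb) //.
by rewrite -mulrA mulrCA ler_wpM2l.
Qed.

(** The eigenvalues of 1 - S on range S lie in ]-1, 1[: expanding
    |v - S v|^2 and bounding |S v|^2 by (2 - delta) v^T S v leaves
    |v|^2 - delta v^T S v, and coercivity finishes. *)
Lemma psd_contraction S delta : symmetric_psd S -> 0 < delta <= 2 ->
    (forall v, form S v v <= (2 - delta) * sqnorm v) ->
  exists r, [/\ 0 <= r, r < 1 & forall w,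
    sqnorm ((1%:M - S) *m (S *m w)) <= r * sqnorm (S *m w)].
Proof.
move=> psdS /andP[d0 d2] Sd; have [c c0 cS] := psd_coercive psdS.
(* 1 - delta c is negative only if range S is trivial. *)
exists (Num.max 0 (1 - delta * c)); split => [||w].
- by rewrite le_max lexx.
- by rewrite gt_max ltr01 /= gtrBl mulr_gt0.
set v := S *m w.
have -> : sqnorm ((1%:M - S) *m v)
        = sqnorm v - 2 * form S v v + sqnorm (S *m v).
  rewrite mulmxBl mul1mx /sqnorm !(formDl, formDr, formNl, formNr) form_mulr.
  rewrite (formC (S *m v) v (trmx1 _ _)) form_mulr; lra.
have := psd_sqnorm_mul_le psdS _ Sd v; rewrite subr_ge0 => /(_ d2) Sv.
have := cS w; rewrite -/v => /(ler_wpM2l (ltW d0)) cv.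
apply: (@le_trans _ _ ((1 - delta * c) * sqnorm v)); first by lra.
by rewrite ler_wpM2r ?sqnorm_ge0 // le_max lexx orbT.
Qed.

End Form.

(** The supremum defining the spectral norm is that of a bounded set, since
    |M u|^2 is the form of M^T M; homogeneity then removes |v| = 1. *)
Lemma mulmx_le_enorm (R : realType) (m p : nat) (M : 'M[R]_(m, p))
    (v : 'cV[R]_p) :
  enorm (M *m v) <= spectral_norm M * enorm v.
Proof.
have [K K0 leK] := form_le_sqnorm (M^T *m M).
have MK (u : 'cV[R]_p) : sqnorm (M *m u) <= K * sqnorm u.
  by have := leK u; rewrite /sqnorm /form trmx_mul !mulmx1 !mulmxA.
have [v0|v_neq0] := eqVneq (sqnorm v) 0.
  have /eqP -> : v == 0 by rewrite -sqnorm_eq0 v0.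
  by rewrite mulmx0 !enormE /sqnorm /form !mulmx0 mxE sqrtr0 mulr0.
have ev : 0 < enorm v by rewrite enormE sqrtr_gt0 lt_def v_neq0 sqnorm_ge0.
have enormZ q a (u : 'cV[R]_q) : 0 <= a -> enorm (a *: u) = a * enorm u.
  move=> a0; rewrite !enormE /sqnorm formZl formZr mulrA -expr2.
  by rewrite sqrtrM ?sqr_ge0 // sqrtr_sqr ger0_norm.
rewrite -ler_pdivrMr // mulrC -enormZ ?invr_ge0 ?enorm_ge0 // scalemxAr.
apply: ub_le_sup.
  exists (Num.sqrt K) => _ [u u1 <-].
  rewrite enormE ler_sqrt; last exact: ltW.
  by rewrite (le_trans (MK u)) // -enorm_sqr u1 expr1n mulr1.
exists ((enorm v)^-1 *: v) => //=.
by rewrite enormZ ?invr_ge0 ?enorm_ge0 // mulVf // gt_eqF.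
Qed.

Lemma form_le_spectral_norm (R : realType) (m : nat) (M : 'M[R]_m)
    (v : 'cV[R]_m) :
  form M v v <= spectral_norm M * sqnorm v.
Proof.
rewrite -form_mulr; apply: (@le_trans _ _ (enorm v * enorm (M *m v))).
  rewrite (le_trans (ler_norm _)) // -(@ler_pXn2r _ 2) //;
    rewrite ?nnegrE ?mulr_ge0 ?enorm_ge0 //.
  rewrite real_normK ?num_real // exprMn !enorm_sqr.
  exact: psd_CauchySchwarz (psd_scalar1 _ _).
rewrite -enorm_sqr expr2 mulrCA ler_wpM2l ?enorm_ge0 //.
exact: mulmx_le_enorm.
Qed.

(** Quantitatively, k (1 - q) q^k <= 1 - q^k (each of the k terms of
    1 + q + ... + q^(k-1) is at least q^k), so that k (1 - q) e stays below C,
    which the Archimedean property forbids when e > 0. *)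
Lemma geometric_bound_le0 (R : realType) (e C q : R) : 0 <= q -> q < 1 ->
  (forall k, e <= C * q ^+ k) -> e <= 0.
Proof.
move=> q0 q1 le_e; rewrite leNgt; apply/negP => e0.
have C0 : 0 < C by have := le_e 0%N; rewrite expr0 mulr1; apply: lt_le_trans.
have kq k : k%:R * (1 - q) * q ^+ k <= 1 - q ^+ k.
  elim: k => [|k IHk]; first by rewrite !mul0r expr0 subrr.
  have qk0 : 0 <= q ^+ k by exact: exprn_ge0.
  have qk1 : q ^+ k <= 1 by rewrite exprn_ile1 // ltW.
  rewrite -natr1 exprS; move: (q ^+ k) (k%:R : R) IHk qk0 qk1 => t r IHk t0 t1.
  have qIH : q * (r * (1 - q) * t) <= q * (1 - t) by rewrite ler_wpM2l.
  have : 0 <= (1 - q) * (1 - q * t).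
    by rewrite mulr_ge0 ?subr_ge0 ?mulr_ile1 // ltW.
  lra.
have ke k : k%:R * (1 - q) * e <= C.
  apply: (@le_trans _ _ (C * (k%:R * (1 - q) * q ^+ k))).
    rewrite [leRHS]mulrCA ler_wpM2l // mulr_ge0 // subr_ge0 ltW //.
  rewrite -[leRHS]mulr1 ler_pM2l // (le_trans (kq k)) // gerBl exprn_ge0 //.
have d0 : 0 < (1 - q) * e by rewrite mulr_gt0 // subr_gt0.
have := ke (Num.bound (C / ((1 - q) * e))).
rewrite -mulrA -ler_pdivlMr // leNgt => /negP; apply.
by apply: archi_boundP; rewrite divr_ge0 // ltW.
Qed.

(** * The matrix-weighted Laplacian *)

Section Graph.
Variables (R : realType) (n d : nat) (G : mwgraph R n d).
Hypotheses (hund : undirected G) (hsym : symmetric_weights G).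
Local Notation W := (weight G).
Local Notation L := (laplacian G).
Local Notation N := (\sum_(i < n) d)%N.

Lemma weight_sym i j : W i j = W j i.
Proof.
have [ij|nij] := boolP (edge G i j); first exact: hsym.
by rewrite !weight_nonedge // hund.
Qed.

Lemma psd_weight i j : symmetric_psd (W i j).
Proof.
have [ij|nij] := boolP (edge G i j); first exact: weight_psd.
rewrite weight_nonedge //; split=> [|v]; first by rewrite trmx0.
by rewrite mulmx0 mul0mx mxE.
Qed.

Lemma block_degreeE i : block_degree G i = \sum_j W i j.
Proof.
rewrite /block_degree big_mkcond; apply: eq_bigr => j _.
by case: ifP => // /negbT /weight_nonedge.
Qed.

Lemma laplacian_sym : L^T = L.
Proof.
rewrite /laplacian linearB /= /degree_matrix /adjacency_matrix.
rewrite tr_mxdiag tr_mxblock.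
congr (_ - _).
  apply: eq_mxdiag => i; rewrite block_degreeE linear_sum /=.
  by apply: eq_bigr => j _; case: (psd_weight i j).
apply: eq_mxblock => i j; rewrite weight_sym.
by case: (psd_weight i j).
Qed.

Lemma laplacian_consensus p (B : 'M[R]_(d, p)) : L *m col_kron (ones n) B = 0.
Proof.
rewrite /laplacian mulmxBl /col_kron mul_mxdiag_mxcol mul_mxblock_mxrow -mxcolB.
rewrite -[RHS](@mxcol0 _ _ (fun=> d)); apply: eq_mxcol => i.
rewrite block_degreeE mxE scale1r mulmx_suml -sumrB big1 // => j _.
by rewrite mxE scale1r subrr.
Qed.

Lemma degree_form (x : 'cV[R]_N) :
  form (degree_matrix G) x x =
  \sum_i form (block_degree G i) (submxcol x i) (submxcol x i).
Proof.
rewrite /form -{1 2}(submxcolK x) tr_mxcol mul_mxrow_mxdiag mul_mxrow_mxcol.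
by rewrite summxE.
Qed.

Lemma adjacency_form (x : 'cV[R]_N) :
  form (adjacency_matrix G) x x =
  \sum_i \sum_j form (W i j) (submxcol x i) (submxcol x j).
Proof.
rewrite /form -{1 2}(submxcolK x) tr_mxcol mul_mxrow_mxblock mul_mxrow_mxcol.
rewrite exchange_big summxE; apply: eq_bigr => j _.
by rewrite mulmx_suml summxE.
Qed.

(** The form of D - A (s = -1) and of D + A (s = 1) at once: twice it is the
    sum over all i, j of (x_i + s x_j)^T A_ij (x_i + s x_j), because the terms
    x_j^T A_ij x_j add up to the degree form again by A_ij = A_ji. *)
Lemma degree_signed_adjacency_ge0 (s : R) (x : 'cV[R]_N) : s ^+ 2 = 1 ->
  0 <= form (degree_matrix G) x x + s * form (adjacency_matrix G) x x.
Proof.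
move=> s2; rewrite -(@pmulr_rge0 _ 2) //.
pose X i := submxcol x i.
have -> : 2 * (form (degree_matrix G) x x + s * form (adjacency_matrix G) x x)
    = \sum_i \sum_j form (W i j) (X i + s *: X j) (X i + s *: X j).
  rewrite degree_form adjacency_form.
  have Ed : \sum_i form (block_degree G i) (X i) (X i)
          = \sum_i \sum_j form (W i j) (X i) (X i).
    apply: eq_bigr => i _; rewrite block_degreeE /form mulmx_sumr mulmx_suml.
    by rewrite summxE.
  have Ed' : \sum_i \sum_j form (W i j) (X i) (X i)
           = \sum_i \sum_j form (W i j) (X j) (X j).
    rewrite exchange_big; apply: eq_bigr => i _; apply: eq_bigr => j _.
    by rewrite weight_sym.
  rewrite mulrDr mulr_natl mulr2n {2}Ed Ed' Ed mulrA !mulr_sumr -!big_split.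
  apply: eq_bigr => i _; rewrite mulr_sumr -!big_split /=.
  apply: eq_bigr => j _.
  rewrite !(formDl, formDr, formZl, formZr).
  rewrite (formC (X j) (X i) (proj1 (psd_weight i j))) mulrA -expr2 s2 /X; ring.
apply: sumr_ge0 => i _; apply: sumr_ge0 => j _.
by case: (psd_weight i j) => _; apply.
Qed.

Lemma laplacian_psd : symmetric_psd L.
Proof.
split=> [|x]; first exact: laplacian_sym.
have := @degree_signed_adjacency_ge0 (-1) x; rewrite sqrrN expr1n => /(_ erefl).
by rewrite -/(form L x x) /laplacian formBmx mulN1r.
Qed.

Lemma degree_form_le (x : 'cV[R]_N) :
  form (degree_matrix G) x x <= max_degree_norm G * sqnorm x.
Proof.
have -> : sqnorm x = \sum_i sqnorm (submxcol x i).
  rewrite /sqnorm /form -{1 2}(submxcolK x) mulmx1 tr_mxcol.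
  rewrite mul_mxrow_mxcol summxE.
  by apply: eq_bigr => i _; rewrite mulmx1.
rewrite degree_form mulr_sumr; apply: ler_sum => i _.
apply: (le_trans (form_le_spectral_norm _ _)).
by rewrite ler_wpM2r ?sqnorm_ge0 // /max_degree_norm le_bigmax.
Qed.

Lemma laplacian_form_le (x : 'cV[R]_N) :
  form L x x <= 2 * max_degree_norm G * sqnorm x.
Proof.
have := @degree_signed_adjacency_ge0 1 x; rewrite expr1n mul1r => /(_ erefl) DA.
have := degree_form_le x; rewrite /laplacian formBmx; lra.
Qed.

Lemma max_degree_norm_ge0 : 0 <= max_degree_norm G.
Proof. by rewrite /max_degree_norm bigmax_ge_id. Qed.

End Graph.

(** * Consensus vectors *)

Section Kron.
Variables (R : realType) (n d : nat).
Local Notation N := (\sum_(i < n) d)%N.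
Local Notation E := (col_kron (ones n) (1%:M : 'M[R]_d)).

Lemma col_kronE p (B : 'M[R]_(d, p)) : col_kron (ones n) B = E *m B.
Proof.
by rewrite /col_kron mxcol_mul; apply: eq_mxcol => i; rewrite -scalemxAl mul1mx.
Qed.

Lemma row_kron_ones : row_kron (ones n)^T (1%:M : 'M[R]_d) = E^T.
Proof.
rewrite /row_kron /col_kron tr_mxcol; apply: eq_mxrow => i.
by rewrite linearZ /= trmx1 !mxE.
Qed.

Lemma kron_gram : E^T *m E = n%:R%:M.
Proof.
rewrite /col_kron tr_mxcol mul_mxrow_mxcol.
rewrite (eq_bigr (fun=> 1%:M)) => [|i _]; last first.
  by rewrite mxE scale1r trmx1 mulmx1.
by rewrite sumr_const card_ord -scaler_nat scalemx1.
Qed.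

Lemma block_sum_sub_average (x : 'cV[R]_N) : (0 < n)%N ->
  E^T *m (x - col_kron (ones n) (block_average x)) = 0.
Proof.
move=> n0; rewrite (col_kronE (block_average x)) mulmxBr mulmxA kron_gram.
rewrite /block_average row_kron_ones.
by rewrite mul_scalar_mx scalerA mulfV ?scale1r ?subrr // pnatr_eq0 -lt0n.
Qed.

(** The range of a symmetric S is the orthogonal complement of its null space;
    E^T v = 0 makes v orthogonal to range E, hence to the null space. *)
Lemma block_sum0_in_range (S : 'M[R]_N) (v : 'cV[R]_N) : S^T = S ->
    (null_space S `<=` range_space E)%classic ->
  E^T *m v = 0 -> exists w, v = S *m w.
Proof.
move=> sS nullS Ev.
(* The columns of the cokernel matrix of S span its null space. *)
have /submxP [D vD] : (v^T <= S)%MS.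
  rewrite submxE; apply/eqP/matrixP => i j; rewrite mxE [RHS]mxE.
  have /nullS [y _ Ey] : null_space S (col j (cokermx S)).
    by rewrite /null_space /= colE mulmxA mulmx_coker mul0mx.
  transitivity ((v^T *m col j (cokermx S)) i 0).
    by rewrite mxE; apply: eq_bigr => k _; rewrite !mxE.
  by rewrite -Ey mulmxA -[v^T *m E]trmxK trmx_mul trmxK Ev trmx0 mul0mx mxE.
by exists D^T; rewrite -[LHS]trmxK vD trmx_mul sS.
Qed.

End Kron.

Theorem theorem2 (R : realType) (n d : nat) (hn : (0 < n)%N) (hd : (2 <= d)%N)
    (G : mwgraph R n d) (hund : undirected G) (hsym : symmetric_weights G)
    (hconn : connected_graph G) (beta : R) (hbeta : 0 < beta)
    (alpha : R) (halpha : alpha = 1 / (max_degree_norm G + beta)) :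
  (forall x : nat -> 'cV[R]_(\sum_(i < n) d),
     (forall k, x k.+1 = (1%:M - alpha *: laplacian G) *m x k) ->
     converges_geometrically x (col_kron (ones n) (block_average (x 0%N))))
  <->
  null_space (laplacian G) = range_space (col_kron (ones n) (1%:M : 'M[R]_d)).
Proof.
have mu0 := max_degree_norm_ge0 G.
have a0 : 0 < alpha by rewrite halpha div1r invr_gt0 ltr_wpDl.
set L := laplacian G; set E := col_kron (ones n) 1%:M.
have LE0 : L *m E = 0 by exact: laplacian_consensus.
have Lsym : L^T = L by exact: laplacian_sym.
split=> [conv|nullL].
  apply/seteqP; split=> [v Lv0|_ [y _ <-]]; last first.
    by rewrite /null_space /= mulmxA LE0 mul0mx.
  (* A null vector is a fixed point of the iteration. *)
  have [|C [q [_ q0 q1 vC]]] := conv (fun=> v).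
    by move=> _; rewrite mulmxBl mul1mx -scalemxAl Lv0 scaler0 subr0.
  have v_avg : v = E *m block_average v.
    apply/eqP; rewrite -col_kronE -subr_eq0 -sqnorm_eq0 -enorm_sqr sqrf_eq0.
    by rewrite eq_le enorm_ge0 andbT; apply: geometric_bound_le0 vC.
  by exists (block_average v).
move=> x xS; pose S := alpha *: L.
pose xstar := col_kron (ones n) (block_average (x 0%N)).
have psdS : symmetric_psd S.
  have [_ L0] := laplacian_psd hund hsym.
  split=> [|v]; first by rewrite linearZ /= Lsym.
  by rewrite -/(form S v v) formZmx; apply: mulr_ge0; [exact: ltW | exact: L0].
have mub0 : 0 < max_degree_norm G + beta by rewrite ltr_wpDl.
have amb : alpha * (max_degree_norm G + beta) = 1.
  by rewrite halpha mulfVK // gt_eqF.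
(* 2 - delta = 2 alpha mu, the upper bound on S inherited from L <= 2 mu. *)
pose delta := 2 * alpha * beta.
have d_gt0 : 0 < delta <= 2.
  rewrite /delta !mulr_gt0 //= -mulrA ger_pMr // -amb ler_pM2l // lerDr //.
have Sd v : form S v v <= (2 - delta) * sqnorm v.
  have -> : 2 - delta = alpha * (2 * max_degree_norm G).
    by rewrite /delta -[X in X - _]mulr1 -amb; ring.
  rewrite formZmx -mulrA ler_pM2l //; exact: laplacian_form_le.
have [r [r0 r1 contr]] := psd_contraction psdS d_gt0 Sd.
have err_step k : x k.+1 - xstar = (1%:M - S) *m (x k - xstar).
  rewrite xS mulmxBr; congr (_ - _).
  by rewrite mulmxBl mul1mx -scalemxAl laplacian_consensus ?scaler0 ?subr0.
have err_sum k : E^T *m (x k - xstar) = 0.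
  elim: k => [|k IHk]; first exact: block_sum_sub_average.
  rewrite err_step mulmxBl mul1mx mulmxBr IHk sub0r mulmxA -scalemxAr.
  by rewrite -Lsym -trmx_mul LE0 trmx0 scaler0 mul0mx oppr0.
have err_contr k : sqnorm (x k.+1 - xstar) <= r * sqnorm (x k - xstar).
  rewrite err_step.
  have [|w ->] := @block_sum0_in_range _ _ _ S _ (proj1 psdS) _ (err_sum k).
    move=> v /eqP; rewrite -scalemxAl scaler_eq0 gt_eqF //= => /eqP Lv.
    by rewrite -/E -nullL.
  exact: contr.
have err_le k : sqnorm (x k - xstar) <= r ^+ k * sqnorm (x 0%N - xstar).
  elim: k => [|k IHk]; first by rewrite mul1r.
  by rewrite (le_trans (err_contr k)) // exprS -mulrA ler_wpM2l.
exists (enorm (x 0%N - xstar)), (Num.sqrt r); split.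
- exact: enorm_ge0.
- exact: sqrtr_ge0.
- by rewrite -sqrtr1 ltr_sqrt.
move=> k; rewrite -(@ler_pXn2r _ 2) //;
  rewrite ?nnegrE ?mulr_ge0 ?exprn_ge0 ?enorm_ge0 ?sqrtr_ge0 //.
by rewrite exprMn !enorm_sqr -exprM mulnC exprM sqr_sqrtr // mulrC.
Qed.
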